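(* Let $f:\mathbb{R}^d\to\mathbb{R}$ be $L$-smooth with minimizer $x^*$, and let the probability distribution $\mathcal{D}$ on $\mathbb{R}^d$ satisfy Assumption D (see context) with constants $\gamma_{\mathcal D}$, $\mu_{\mathcal D}$ and norm $\|\cdot\|_{\mathcal D}$. Let SMTP with constant stepsize $\gamma^k\equiv\gamma>0$ produce points $z^0,z^1,\ldots,z^{K-1}$ and let $\overline{z}^K$ be chosen uniformly at random among them. Then $$\mathbf{E}\left[\|\nabla f(\overline{z}^K)\|_{\mathcal D}\right]\le \frac{(1-\beta)(f(x^0)-f(x^* ))}{K\gamma\mu_{\mathcal D}}+\frac{L\gamma\gamma_{\mathcal D}}{2\mu_{\mathcal D}(1-\beta)}.$$ Moreover, if $\gamma=\frac{\gamma_0}{\sqrt K}$, then $$\mathbf{E}\left[\|\nabla f(\overline{z}^K)\|_{\mathcal D}\right]\le \frac{1}{\sqrt K}\left(\frac{(1-\beta)(f(z^0)-f(x^* ))}{\gamma_0\mu_{\mathcal D}}+\frac{L\gamma_0\gamma_{\mathcal D}}{2\mu_{\mathcal D}(1-\beta)}\right).$$ The choice $\gamma_0=\sqrt{\frac{2(1-\beta)^2(f(x^0)-f(x^* ))}{L\gamma_{\mathcal D}}}$ minimizes the right-hand side of the last inequality, and for this choice $$\mathbf{E}\left[\|\nabla f(\overline{z}^K)\|_{\mathcal D}\right]\le \frac{\sqrt{2(f(x^0)-f(x^* ))L\gamma_{\mathcal D}}}{\mu_{\mathcal D}\sqrt K}.$$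
   Context: $f:\mathbb{R}^d\to\mathbb{R}$ is differentiable, not necessarily convex, and bounded from below by $f(x^* )$, where $x^*$ is a minimizer. $f$ is $L$-smooth if $\|\nabla f(x)-\nabla f(y)\|_2\le L\|x-y\|_2$ for all $x,y\in\mathbb{R}^d$. Assumption D on the distribution $\mathcal D$: (1) $\gamma_{\mathcal D}:=\mathbf{E}_{s\sim\mathcal D}\|s\|_2^2$ is finite; (2) there is a constant $\mu_{\mathcal D}>0$ and a norm $\|\cdot\|_{\mathcal D}$ on $\mathbb{R}^d$ such that $\mathbf{E}_{s\sim\mathcal D}|\langle g,s\rangle|\ge\mu_{\mathcal D}\|g\|_{\mathcal D}$ for all $g\in\mathbb{R}^d$. Algorithm SMTP (Stochastic Momentum Three Points). Input: stepsizes (learning rates) $\{\gamma^k\}_{k\ge0}$, starting point $x^0\in\mathbb{R}^d$, distribution $\mathcal D$ on $\mathbb{R}^d$, momentum parameter $0\le\beta<1$. Set $v^{-1}=0$, $z^0=x^0$. For $k=0,1,\ldots$: sample $s^k\sim\mathcal D$ (independently of the past); let $v_\pm^k=\beta v^{k-1}\pm s^k$; $x_\pm^{k+1}=x^k-\gamma^kv_\pm^k$; $z_\pm^{k+1}=x_\pm^{k+1}-\frac{\gamma^k\beta}{1-\beta}v_\pm^k$; let $z^{k+1}$ be a point among $z^k,z_+^{k+1},z_-^{k+1}$ with the smallest value of $f$; and set $(x^{k+1},v^k)=(x_+^{k+1},v_+^k)$ if $z^{k+1}=z_+^{k+1}$, $(x^{k+1},v^k)=(x_-^{k+1},v_-^k)$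 if $z^{k+1}=z_-^{k+1}$, and $(x^{k+1},v^k)=(x^k,v^{k-1})$ if $z^{k+1}=z^k$. $\mathbf{E}$ denotes expectation with respect to all randomness. *)

(* Defs.v *)
From HB Require Import structures.
From mathcomp Require Import all_boot all_order all_algebra.
From mathcomp Require Import all_classical all_reals all_analysis.
Import Order.TTheory GRing.Theory Num.Theory.
Import numFieldNormedType.Exports.

Set Implicit Arguments.
Unset Strict Implicit.
Unset Printing Implicit Defensive.

Local Open Scope classical_set_scope.
Local Open Scope ring_scope.

(* Vectors of R^d are row vectors, measurable for the Borel sigma-algebra of
   the library topology on matrices. *)
HB.instance Definition _ (R : realType) (m n : nat) :=
  @isMeasurable.Build (sigma_display (@open 'M[R]_(m, n))) 'M[R]_(m, n)
    <<s @open 'M[R]_(m, n) >> (@sigma_algebra0 _ setT _) (@sigma_algebraC _ _)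
    (@sigma_algebra_bigcup _ setT _).

Section euclidean.
Context {R : realType} {d : nat}.
Implicit Types (x y : 'rV[R]_d) (f : 'rV[R]_d -> R) (N : 'rV[R]_d -> R).

Definition dotv x y : R := \sum_(i < d) x 0 i * y 0 i.

(* The library norm on matrices is the sup norm, hence this definition. *)
Definition norm2 x : R := Num.sqrt (dotv x x).

(* Nonnegativity of N and N 0 = 0 follow from these axioms. *)
Definition is_norm N : Prop :=
  [/\ forall x y, N (x + y) <= N x + N y,
      forall (a : R) x, N (a *: x) = `|a| * N x
    & forall x, N x = 0 -> x = 0].

Definition gradient f x : 'rV[R]_d := \row_i 'D_(delta_mx 0 i) f x.

Definition L_smooth f (L : R) : Prop :=
  forall x y, norm2 (gradient f x - gradient f y) <= L * norm2 (x - y).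

Definition minimizer f x : Prop := forall y, f x <= f y.

Record assumption_D (D : probability 'rV[R]_d R) (gammaD muD : R)
    (normD : 'rV[R]_d -> R) : Prop := AssumptionD {
  second_moment_D : ('E_D[fun s => (norm2 s ^+ 2)%R] = gammaD%:E)%E ;
  muD_gt0 : 0 < muD ;
  normD_norm : is_norm normD ;
  muD_lower_bound : forall g,
    ((muD * normD g)%R%:E <= 'E_D[fun s => `|dotv g s|%R])%E }.

End euclidean.

(* One iteration of SMTP, from (x^k, v^(k-1), z^k) with sample s^k to
   (x^(k+1), v^k, z^(k+1)).  Ties in f are broken arbitrarily.  The three cases
   are a choice of candidate, not a test on the value of z^(k+1): distinct
   candidates can have the same z (when s^k = 0, z_+ = z_- may equal z^k while
   x_+ differs from x^k). *)
Definition smtp_step (R : realType) (d : nat) (f : 'rV[R]_d -> R)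
    (gamma beta : R) (s x v z x' v' z' : 'rV[R]_d) : Prop :=
  let vp := beta *: v + s in
  let vm := beta *: v - s in
  let xp := x - gamma *: vp in
  let xm := x - gamma *: vm in
  let zp := xp - (gamma * beta / (1 - beta)) *: vp in
  let zm := xm - (gamma * beta / (1 - beta)) *: vm in
  [/\ f z' <= f z, f z' <= f zp & f z' <= f zm] /\
  [\/ [/\ z' = zp, x' = xp & v' = vp],
      [/\ z' = zm, x' = xm & v' = vm]
    | [/\ z' = z, x' = x & v' = v]].

Section random_run.
Context {R : realType} {d : nat} {dO : measure_display}
        {Omega : measurableType dO} {P : probability Omega R}.
Implicit Types (s x v z : nat -> {RV P >-> 'rV[R]_d}).

Definition independent_of (F : set (set Omega)) (X : {RV P >-> 'rV[R]_d}) :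
    Prop :=
  forall A B, F A -> measurable B ->
    P (A `&` X @^-1` B) = (P A * P (X @^-1` B))%E.

(* The sigma-algebra generated by everything computed before s^k is sampled:
   s^0, ..., s^(k-1) and x^j, v^(j-1), z^j for j <= k. *)
Definition past s x v z (k : nat) : set (set Omega) :=
  <<s [set A | exists (j : nat) (B : set 'rV[R]_d), measurable B /\
        ((j < k)%N /\ A = s j @^-1` B \/
         (j <= k)%N /\
           [\/ A = x j @^-1` B, A = v j @^-1` B | A = z j @^-1` B])] >>.

(* Index shift: v k is v^(k-1), so v 0 is v^(-1). *)
Record smtp (f : 'rV[R]_d -> R) (gamma : nat -> R) (beta : R) (x0 : 'rV[R]_d)
    (D : probability 'rV[R]_d R) s x v z : Prop := SMTP {
  smtp_x0 : forall w, x 0%N w = x0 ;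
  smtp_v0 : forall w, v 0%N w = 0 ;
  smtp_z0 : forall w, z 0%N w = x0 ;
  smtp_sample : forall k A, measurable A -> distribution P (s k) A = D A ;
  smtp_indep : forall k, independent_of (past s x v z k) (s k) ;
  smtp_stepP : forall k w,
    smtp_step f (gamma k) beta (s k w) (x k w) (v k w) (z k w)
      (x k.+1 w) (v k.+1 w) (z k.+1 w) }.

(* J is a uniform index in {0, ..., K-1}, independent of z^0, ..., z^(K-1);
   the point chosen uniformly at random is z^J. *)
Record uniform_index z (K : nat) (J : Omega -> 'I_K) : Prop := UniformIndex {
  index_measurable : forall i, measurable (J @^-1` [set i]) ;
  index_uniform : forall i, P (J @^-1` [set i]) = (K%:R^-1)%:E ;
  index_indep : forall A i,
    g_sigma_preimage (fun j : 'I_K => z j : Omega -> 'rV[R]_d) A ->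
    P (A `&` J @^-1` [set i]) = (P A * P (J @^-1` [set i]))%E }.

End random_run.

(* Main.v *)
Require Import Defs.
From HB Require Import structures.
From mathcomp Require Import all_boot all_order all_algebra.
From mathcomp Require Import all_classical all_reals all_analysis.
From mathcomp Require Import measurable_realfun ring lra.
Import Order.TTheory GRing.Theory Num.Theory.
Import numFieldNormedType.Exports.

Local Open Scope classical_set_scope.
Local Open Scope ring_scope.

(** Momentum disappears in the right variable: z^k is always
    x^k - (gamma beta / (1 - beta)) v^(k-1), so the two trial points are
    z^k - eta s^k and z^k + eta s^k with eta = gamma / (1 - beta)
    (virtual_iterate). SMTP is thus, in the variable z, the plain three points
    method with stepsize eta. The descent lemma for L-smooth functions at the two
    trial points gives, for every outcome,

      eta |<grad f(z^k), s^k>| <= f(z^k) - f(z^(k+1)) + (L/2) eta^2 |s^k|^2,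

    which telescopes over k < K (pathwise_sum_bound). The values of f are bounded
    from below by f(x_star), so after this step only nonnegative quantities have
    to be integrated and no integrability question arises
    (expected_gradient_sum_bound). On the right E|s^k|^2 = gammaD. On the left
    s^k is independent of z^k, so the joint law of (z^k, s^k) is a product, and
    Tonelli's theorem together with the lower bound assumed on D gives
    E|<grad f(z^k), s^k>| >= muD E normD(grad f(z^k)) (expected_abs_dot_gradient).
    Since J is uniform and independent of the iterates, the expectation at z^J is
    the average of the expectations at z^0, ..., z^(K-1)
    (uniform_index_integral). This is the first bound, and the second is the
    first rewritten with gamma = gamma0 / sqrt K.

    As a function of gamma0 the right-hand side is a / gamma0 + b gamma0 up to the
    factor 1 / sqrt K, which is minimal where b gamma0^2 = a, with value
    2 b gamma0. The only delicate points are the degenerate cases. If d = 0, the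
    constant L may be negative, but then gammaD = 0, and replacing L by its
    absolute value changes nothing. If f(x_star) < f(x0), then L > 0 (otherwise f
    lies below its tangent planes, hence is constant: L_smooth_gt0) and
    gammaD > 0 (otherwise E|<g, s>| vanishes for every g: gammaD_gt0), so the
    optimal gamma0 is positive. If f(x_star) = f(x0), the optimal value is 0 and,
    with the convention 1 / 0 = 0, the right-hand side there is 0 as well. *)

(** * Euclidean geometry and norms *)

Section euclidean_inner_product.
Context {R : realType} {d : nat}.
Implicit Types x y z : 'rV[R]_d.

Lemma dotvC x y : dotv x y = dotv y x.
Proof. by apply: eq_bigr => i _; rewrite mulrC. Qed.

Lemma dotvDr x y z : dotv x (y + z) = dotv x y + dotv x z.
Proof. by rewrite /dotv -big_split; apply: eq_bigr => i _; rewrite mxE mulrDr. Qed.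

Lemma dotvZr a x y : dotv x (a *: y) = a * dotv x y.
Proof. by rewrite /dotv mulr_sumr; apply: eq_bigr => i _; rewrite mxE mulrCA. Qed.

Lemma dotvDl x y z : dotv (x + y) z = dotv x z + dotv y z.
Proof. by rewrite dotvC dotvDr !(dotvC z). Qed.

Lemma dotvZl a x y : dotv (a *: x) y = a * dotv x y.
Proof. by rewrite dotvC dotvZr dotvC. Qed.

Lemma dotvNr x y : dotv x (- y) = - dotv x y.
Proof. by rewrite -scaleN1r dotvZr mulN1r. Qed.

Lemma dotvNl x y : dotv (- x) y = - dotv x y.
Proof. by rewrite dotvC dotvNr dotvC. Qed.

Lemma dotvv_ge0 x : 0 <= dotv x x.
Proof. by apply: sumr_ge0 => i _; rewrite -expr2 sqr_ge0. Qed.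

Lemma norm2_ge0 x : 0 <= norm2 x.
Proof. exact: sqrtr_ge0. Qed.

Lemma sqr_norm2 x : norm2 x ^+ 2 = dotv x x.
Proof. by rewrite sqr_sqrtr// dotvv_ge0. Qed.

Lemma norm2Z a x : norm2 (a *: x) = `|a| * norm2 x.
Proof.
by rewrite /norm2 dotvZl dotvZr mulrA -expr2 sqrtrM ?sqr_ge0// sqrtr_sqr.
Qed.

Lemma norm2N x : norm2 (- x) = norm2 x.
Proof. by rewrite -scaleN1r norm2Z normrN1 mul1r. Qed.

Lemma ler_coord_norm2 x i : `|x 0 i| <= norm2 x.
Proof.
rewrite -sqrtr_sqr ler_sqrt ?dotvv_ge0// /dotv (bigD1 i)//= -expr2 lerDl.
by apply: sumr_ge0 => j _; rewrite -expr2 sqr_ge0.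
Qed.

Lemma norm2_eq0 x : norm2 x = 0 -> x = 0.
Proof.
move=> x0; apply/rowP => i; rewrite mxE; apply/eqP.
by rewrite -normr_le0 -x0 ler_coord_norm2.
Qed.

Lemma norm2_sup_norm x : norm2 x <= Num.sqrt d%:R * `|x|.
Proof.
rewrite -[`|x|]ger0_norm// -sqrtr_sqr -sqrtrM// ler_sqrt ?mulr_ge0 ?sqr_ge0//.
have -> : d%:R * `|x| ^+ 2 = \sum_(i < d) `|x| ^+ 2.
  by rewrite sumr_const card_ord mulr_natl.
apply: ler_sum => i _.
rewrite -expr2 -real_normK ?num_real// lerXn2r ?nnegrE//.
by rewrite [leRHS]/Num.norm/= mx_normrE; apply/bigmax_geP; right; exists (0, i).
Qed.

Lemma cauchy_schwarz x y : dotv x y <= norm2 x * norm2 y.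
Proof.
have [/norm2_eq0 ->|y_neq0] := eqVneq (norm2 y) 0.
  by rewrite -(scale0r (0 : 'rV_d)) dotvZr mul0r mulr_ge0 ?norm2_ge0.
have yy_gt0 : 0 < dotv y y by rewrite -sqr_norm2 exprn_even_gt0.
(* the residual of x after projection on y, scaled by dotv y y *)
have := dotvv_ge0 (dotv y y *: x - dotv x y *: y).
rewrite !(dotvDl, dotvDr, dotvNl, dotvNr, dotvZl, dotvZr) (dotvC y x) => res_ge0.
have : 0 <= dotv y y * (dotv x x * dotv y y - dotv x y ^+ 2).
  by move: res_ge0; congr (_ <= _); ring.
rewrite pmulr_rge0// subr_ge0 => sqr_le.
apply: (le_trans (ler_norm _)); rewrite -sqrtr_sqr -sqrtrM ?dotvv_ge0//.
by rewrite ler_sqrt// mulr_ge0// dotvv_ge0.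
Qed.

End euclidean_inner_product.

Section norms_on_row_vectors.
Context {R : realType} {d : nat} {N : 'rV[R]_d -> R}.
Hypothesis normN : is_norm N.

Lemma is_norm0 : N 0 = 0.
Proof. by case: normN => _ NZ _; rewrite -(scale0r 0) NZ normr0 mul0r. Qed.

Lemma is_normN x : N (- x) = N x.
Proof. by case: normN => _ NZ _; rewrite -scaleN1r NZ normrN1 mul1r. Qed.

Lemma is_norm_ge0 x : 0 <= N x.
Proof.
case: normN => ND _ _; have := ND x (- x).
by rewrite subrr is_norm0 is_normN -mulr2n pmulrn_lge0.
Qed.

Lemma is_norm_gt0 x : x != 0 -> 0 < N x.
Proof.
move=> x_neq0; rewrite lt_neqAle is_norm_ge0 andbT eq_sym.
by apply: contra_neq x_neq0; case: normN => _ _; apply.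
Qed.

Lemma is_norm_dist x y : `|N x - N y| <= N (x - y).
Proof.
case: normN => ND _ _; rewrite ler_norml; apply/andP; split.
  have := ND (y - x) x; rewrite subrK -(is_normN (y - x)) opprB => Ny_le.
  by lra.
by have := ND (x - y) y; rewrite subrK => Nx_le; lra.
Qed.

(** Expand x in the canonical basis. This is the half of the equivalence of
    norms that turns the Lipschitz bound on the gradient into one on N o grad f. *)
Lemma is_norm_le_norm2 x :
  N x <= (\sum_i N (delta_mx 0 i)) * norm2 x.
Proof.
case: normN => ND NZ _.
have le_sum (s : seq 'I_d) :
    N (\sum_(i <- s) x 0 i *: delta_mx 0 i)
    <= \sum_(i <- s) `|x 0 i| * N (delta_mx 0 i).
  elim: s => [|i s IH]; first by rewrite !big_nil is_norm0.
  by rewrite !big_cons (le_trans (ND _ _))// NZ lerD2l.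
rewrite {1}[x]row_sum_delta mulr_suml (le_trans (le_sum _))//.
apply: ler_sum => i _.
by rewrite mulrC ler_wpM2l ?is_norm_ge0 ?ler_coord_norm2.
Qed.

End norms_on_row_vectors.

(** The topology comes from the sup norm, to which the Euclidean norm is
    equivalent, so h is continuous. This covers all the functions of a vector
    integrated below: they are built from the coordinates of a sample, the
    coordinates of the gradient and a norm of the gradient. *)
Lemma lipschitz_measurable {R : realType} {d : nat} (C : R) (h : 'rV[R]_d -> R) :
  0 <= C -> (forall x y, `|h x - h y| <= C * norm2 (x - y)) ->
  measurable_fun setT h.
Proof.
move=> C_ge0 lip_h.
have cont_h : continuous h.
  pose B := C * Num.sqrt d%:R + 1.
  have B_gt0 : 0 < B by rewrite ltr_wpDl// mulr_ge0// sqrtr_ge0.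
  move=> x A /= /(nbhs_ballP (h x)) [e e_gt0 ball_sub].
  apply/nbhs_ballP; exists (e / B) => [|y]; first exact: divr_gt0.
  rewrite -ball_normE /= => xy_lt; apply: ball_sub; rewrite -ball_normE /=.
  apply: (@le_lt_trans _ _ (B * `|x - y|)); last by rewrite mulrC -ltr_pdivlMr.
  rewrite (le_trans (lip_h _ _))// mulrDl mul1r ler_wpDr// -mulrA.
  by rewrite ler_wpM2l// norm2_sup_norm.
apply: (measurability _ (RGenOpens.measurableE R)).
move=> _ [_ [a [b ->] <-]]; rewrite setTI; apply: sub_sigma_algebra.
by move/continuousP: cont_h; apply; exact: interval_open.
Qed.

Lemma coord_measurable {R : realType} {d : nat} (i : 'I_d) :
  measurable_fun setT (fun s : 'rV[R]_d => s 0 i).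
Proof.
apply: (lipschitz_measurable 1) => // x y.
by have := ler_coord_norm2 (x - y) i; rewrite !mxE mul1r.
Qed.

Lemma sqr_norm2_measurable {R : realType} {d : nat} :
  measurable_fun setT (fun s : 'rV[R]_d => norm2 s ^+ 2).
Proof.
under eq_fun do rewrite sqr_norm2.
by apply: measurable_sum => i; apply: measurable_funM; exact: coord_measurable.
Qed.

(** * Smooth functions *)

Section smooth_functions.
Context {R : realType} {d : nat} {f : 'rV[R]_d -> R} {L : R}.
Hypothesis f_diff : forall y, differentiable f y.
Hypothesis f_smooth : L_smooth f L.
Implicit Types x y h : 'rV[R]_d.

Lemma gradientE x h : 'D_h f x = dotv (gradient f x) h.
Proof.
rewrite deriveE// {1}[h]row_sum_delta linear_sum; apply: eq_bigr => i _.
by rewrite linearZ/= mxE deriveE// mulrC.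
Qed.

Lemma is_derive_line x h (t : R) :
  is_derive t 1 (fun u : R => f (x + u *: h)) (dotv (gradient f (x + t *: h)) h).
Proof.
(* both derivatives are limits of literally the same difference quotients *)
have quotientE : (fun u : R => u^-1 *:
      (((fun u0 : R => f (x + u0 *: h)) \o shift t) (u *: 1)
       - f (x + t *: h))) =
    (fun u : R => u^-1 *:
      ((f \o shift (x + t *: h)) (u *: h) - f (x + t *: h))).
  apply/funext => u /=.
  by rewrite [u *: 1]mulr1 scalerDl addrCA.
rewrite -gradientE; split; last by rewrite /derive quotientE.
rewrite /derivable quotientE; exact: diff_derivable.
Qed.

(** Along the segment the map t |-> f (x + t h) - t <grad f x, h> - L t^2 |h|^2 / 2
    has derivative <grad f (x + t h) - grad f x, h> - L t |h|^2, nonpositive by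
    Cauchy-Schwarz and smoothness; so it decreases between t = 0 and t = 1. *)
Lemma descent_lemma x h :
  f (x + h) <= f x + dotv (gradient f x) h + L / 2 * norm2 h ^+ 2.
Proof.
pose a := dotv (gradient f x) h; pose b := L / 2 * norm2 h ^+ 2.
pose g (t : R) := f (x + t *: h) - (t * a + t ^+ 2 * b).
pose dg (t : R) := dotv (gradient f (x + t *: h)) h - (a + (t + t) * b).
have g_derive (t : R) : is_derive t 1 g (dg t).
  apply: is_deriveB; first exact: is_derive_line.
  by apply: is_derive_eq; rewrite /GRing.scale /=; ring.
have g_cont : {within `[0, 1], continuous g}.
  apply: continuous_subspaceT => t; apply: differentiable_continuous.
  by apply/derivable1_diffP; case: (g_derive t).
have [c /itvP c01 gE] := @MVT _ g dg 0 1 ltr01 (fun t _ => g_derive t) g_cont.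
have dg_le0 : dg c <= 0.
  have c_ge0 : 0 <= c by rewrite c01.
  rewrite /dg opprD addrA -dotvNl -dotvDl subr_le0.
  apply: (le_trans (cauchy_schwarz _ _)).
  have := f_smooth (x + c *: h) x.
  rewrite addrAC subrr add0r norm2Z ger0_norm// => le_grad.
  apply: (le_trans (ler_wpM2r (norm2_ge0 _) le_grad)).
  by rewrite le_eqVlt; apply/orP; left; apply/eqP; rewrite /b; field.
move: dg_le0; rewrite -[dg c]mulr1 -[X in _ * X](subr0 1) -gE.
by rewrite /g scale1r scale0r addr0 /a /b; lra.
Qed.

(** Applied at both points z + eta s and z - eta s, the descent lemma bounds
    their minimum, because one of the two signs makes the linear term equal to
    -eta |<grad f z, s>|. *)
Lemma three_points_descent (eta : R) z s z' :
  f z' <= f (z - eta *: s) -> f z' <= f (z + eta *: s) ->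
  eta * `|dotv (gradient f z) s|
  <= f z - f z' + L / 2 * eta ^+ 2 * norm2 s ^+ 2.
Proof.
have norm2_eta : norm2 (eta *: s) ^+ 2 = eta ^+ 2 * norm2 s ^+ 2.
  by rewrite norm2Z exprMn real_normK ?num_real.
have := descent_lemma z (- (eta *: s)); have := descent_lemma z (eta *: s).
rewrite dotvNr norm2N norm2_eta dotvZr.
by case: (ger0P (dotv (gradient f z) s)) => _; lra.
Qed.

Lemma gradient_coord_measurable i :
  0 <= L -> measurable_fun setT (fun y => gradient f y 0 i).
Proof.
move=> L_ge0; apply: (lipschitz_measurable L) => // x y.
have := ler_coord_norm2 (gradient f x - gradient f y) i.
by rewrite !mxE => /le_trans; apply.
Qed.

Lemma norm_gradient_measurable (N : 'rV[R]_d -> R) :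
  0 <= L -> is_norm N -> measurable_fun setT (fun y => N (gradient f y)).
Proof.
move=> L_ge0 normN; pose C := \sum_i N (delta_mx 0 i).
have C_ge0 : 0 <= C by apply: sumr_ge0 => i _; exact: is_norm_ge0.
apply: (lipschitz_measurable (C * L)) => [|x y]; first exact: mulr_ge0.
apply: (le_trans (is_norm_dist normN _ _)).
apply: (le_trans (is_norm_le_norm2 normN _)).
by rewrite -mulrA ler_wpM2l.
Qed.

End smooth_functions.

(** This reduces the integral estimates to nonnegative constants. *)
Lemma L_smooth_norm {R : realType} {d : nat} {f : 'rV[R]_d -> R} {L : R} :
  L_smooth f L -> L_smooth f `|L|.
Proof.
by move=> f_smooth x y; rewrite (le_trans (f_smooth x y))// ler_wpM2r
  ?norm2_ge0// ler_norm.
Qed.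

(** * Descent along one run of the algorithm *)

Section pathwise_descent.
Context {R : realType} {d : nat} {f : 'rV[R]_d -> R} {L beta gamma : R}.
Context {x0 : 'rV[R]_d} {s x v z : nat -> 'rV[R]_d}.
Hypotheses (f_diff : forall y, differentiable f y) (f_smooth : L_smooth f L).
Hypothesis beta_lt1 : beta < 1.
Hypotheses (x_init : x 0%N = x0) (v_init : v 0%N = 0) (z_init : z 0%N = x0).
Hypothesis step : forall k, smtp_step f gamma beta (s k) (x k) (v k) (z k)
  (x k.+1) (v k.+1) (z k.+1).

(** A trial point z_+/- is obtained from x_+/- by subtracting
    (gamma beta / (1 - beta)) v_+/-, and rejecting both candidates leaves x, v
    and z unchanged: every case of the step preserves the relation. It relies on
    the stepsize being constant. *)
Lemma virtual_iterate k : z k = x k - (gamma * beta / (1 - beta)) *: v k.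
Proof.
elim: k => [|k IH]; first by rewrite x_init v_init z_init scaler0 subr0.
by case: (step k) => _ [] [-> -> ->].
Qed.

(** Since 1 + beta / (1 - beta) = 1 / (1 - beta), a trial point is
    z_+/- = x - eta (beta v +/- s) with eta = gamma / (1 - beta), and the part
    eta beta v is exactly the offset between x and z. *)
Lemma smtp_three_points k :
  f (z k.+1) <= f (z k - (gamma / (1 - beta)) *: s k) /\
  f (z k.+1) <= f (z k + (gamma / (1 - beta)) *: s k).
Proof.
have beta1_neq0 : 1 - beta != 0 by rewrite subr_eq0 gt_eqF.
have trial (t : 'rV[R]_d) : x k - gamma *: (beta *: v k + t)
    - (gamma * beta / (1 - beta)) *: (beta *: v k + t)
    = z k - (gamma / (1 - beta)) *: t.
  rewrite virtual_iterate; apply/rowP => i; rewrite !mxE; field.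
  by [].
by case: (step k) => -[_]; rewrite !trial scalerN opprK.
Qed.

(** Telescope the three points descent along the run. *)
Lemma pathwise_sum_bound K :
  gamma / (1 - beta) * (\sum_(k < K) `|dotv (gradient f (z k)) (s k)|)
  <= f x0 - f (z K)
     + L / 2 * (gamma / (1 - beta)) ^+ 2 * \sum_(k < K) norm2 (s k) ^+ 2.
Proof.
elim: K => [|K IH]; first by rewrite !big_ord0 z_init !mulr0 subrr add0r.
have [zm_le zp_le] := smtp_three_points K.
have := three_points_descent f_diff f_smooth _ _ _ _ zm_le zp_le.
by rewrite !big_ord_recr /= !mulrDr; lra.
Qed.

End pathwise_descent.

(** * Independence *)

Section independence.
Local Open Scope ereal_scope.
Context {R : realType} {dO d1 d2 : measure_display}.
Context {Omega : measurableType dO} {P : probability Omega R}.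
Context {T1 : measurableType d1} {T2 : measurableType d2}.

(** The joint law of X and Y agrees with the product of the laws on rectangles,
    hence everywhere, and Tonelli's theorem applies. *)
Lemma independent_tonelli (X : {RV P >-> T1}) (Y : {RV P >-> T2})
    (Q : probability T2 R) (g : T1 * T2 -> \bar R) :
  (forall A B, measurable A -> measurable B ->
    P (X @^-1` A `&` Y @^-1` B) = P (X @^-1` A) * Q B) ->
  measurable_fun setT g -> (forall p, 0 <= g p) ->
  \int[P]_w g (X w, Y w) = \int[P]_w \int[Q]_y g (X w, y).
Proof.
move=> indep mg g_ge0.
have mXY : measurable_fun setT (fun w => (X w, Y w)) by exact: measurable_fun_pair.
have /= <- := ge0_integral_distribution X
  (measurable_fun_fubini_tonelli_F (m2 := Q) g mg g_ge0)
  (fun x => integral_ge0 _ (fun y _ => g_ge0 (x, y))).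
have /= <- := fubini_tonelli1 (m1 := distribution P X) (m2 := Q) g mg g_ge0.
have /= <- := ge0_integral_pushforward mXY P measurableT mg (fun p _ => g_ge0 p).
apply/esym/eq_measure_integral => A mA _.
by apply: product_measure_unique => // A1 A2 mA1 mA2; exact: indep.
Qed.

(** Restricting P to B multiplies the law of X by P B. *)
Lemma independent_integral_restrict (X : {RV P >-> T1}) (B : set Omega)
    (g : T1 -> \bar R) :
  measurable B ->
  (forall A, measurable A -> P (X @^-1` A `&` B) = P (X @^-1` A) * P B) ->
  measurable_fun setT g -> (forall x, 0 <= g x) ->
  \int[P]_(w in B) g (X w) = P B * \int[P]_w g (X w).
Proof.
move=> mB indep mg g_ge0.
have mgX : measurable_fun setT (g \o X) by exact: measurableT_comp.
pose PB := mrestr P mB.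
transitivity (\int[PB]_(w in B) g (X w)).
  apply: eq_measure_integral => A mA /setIidl AB.
  by rewrite /PB /= /mrestr AB.
transitivity (\int[PB]_w g (X w)).
  rewrite -[in LHS](setCK B) -setTD; apply/esym/ge0_negligible_integral => //.
    exact: measurableC.
  by rewrite /PB /= /mrestr setICl measure0.
pose c : {nonneg R} := NngNum (fine_ge0 (measure_ge0 P B)).
have cE : c%:num%:E = P B by rewrite /= fineK// fin_num_measure.
have /= <- := ge0_integral_pushforward (measurable_funPT X) PB measurableT mg
  (fun x _ => g_ge0 x).
have /= <- := ge0_integral_distribution X mg g_ge0.
rewrite -cE -ge0_integral_mscale//.
apply: eq_measure_integral => A mA _.
by rewrite /= /mscale cE muleC; exact: indep.
Qed.

End independence.

(** * Expectations *)

Section expected_descent.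
Local Open Scope ereal_scope.
Context {R : realType} {d : nat} {dO : measure_display}.
Context {Omega : measurableType dO} {P : probability Omega R}.

(** Partition Omega according to the value of J; on each block J = i the point
    is z^i, which is independent of the block. *)
Lemma uniform_index_integral (z : nat -> {RV P >-> 'rV[R]_d}) (K : nat)
    (J : Omega -> 'I_K) (g : 'rV[R]_d -> \bar R) :
  uniform_index z J -> measurable_fun setT g -> (forall y, 0 <= g y) ->
  \int[P]_w g (z (J w) w) = K%:R^-1%:E * \sum_(i < K) \int[P]_w g (z i w).
Proof.
move=> [mJ J_unif J_indep] mg g_ge0.
have mgz i : measurable_fun setT (fun w => g (z i w)) by exact: measurableT_comp.
have splitJ w :
    g (z (J w) w) = \sum_(i < K) ((fun w => g (z i w)) \_ (J @^-1` [set i])) w.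
  rewrite (bigD1 (J w))//= big1 ?adde0 => [|i /eqP iJ].
    by rewrite patchE mem_set.
  by rewrite patchE memNset// => /= /esym.
under eq_integral do rewrite splitJ.
rewrite ge0_integral_sum//; last 2 first.
- by move=> i; apply/measurable_restrict => //; apply: measurable_funTS.
- by move=> i w _; exact: erestrict_ge0.
rewrite ge0_sume_distrr; last by move=> i _; exact: integral_ge0.
apply: eq_bigr => i _; rewrite -integral_mkcond -(J_unif i).
apply: independent_integral_restrict => // A mA; apply: J_indep.
apply: sub_sigma_algebra; rewrite (bigD1 i)//=; left.
by exists A; rewrite ?setTI.
Qed.

Context {f : 'rV[R]_d -> R} {L : R} {x0 : 'rV[R]_d}.
Context {D : probability 'rV[R]_d R} {gammaD muD : R} {normD : 'rV[R]_d -> R}.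
Context {beta gamma : R} {s x v z : nat -> {RV P >-> 'rV[R]_d}}.
Hypotheses (f_smooth : L_smooth f L) (L_ge0 : (0 <= L)%R).
Hypothesis HD : assumption_D D gammaD muD normD.
Hypothesis run : smtp f (fun=> gamma) beta x0 D s x v z.

Lemma sample_second_moment k : \int[P]_w (norm2 (s k w) ^+ 2)%:E = gammaD%:E.
Proof.
have m2 : measurable_fun setT (fun y : 'rV[R]_d => (norm2 y ^+ 2)%:E).
  by apply/measurable_EFinP; exact: sqr_norm2_measurable.
have /= <- := ge0_integral_distribution (s k) m2
  (fun y => sqr_ge0 (norm2 y)).
have := second_moment_D HD; rewrite unlock => <-.
by apply: eq_measure_integral => A mA _; exact: (smtp_sample run k mA).
Qed.

Lemma abs_dot_gradient_measurable :
  measurable_fun setT (fun p : 'rV[R]_d * 'rV[R]_d =>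
    `|dotv (gradient f p.1) p.2|%:E).
Proof.
apply/measurable_EFinP; apply: measurableT_comp => //.
apply: measurable_sum => i; apply: measurable_funM.
  apply: (measurableT_comp (gradient_coord_measurable f_smooth i L_ge0)).
  exact: measurable_fst.
exact: measurableT_comp (coord_measurable i) measurable_snd.
Qed.

(** Conditionally on z^k the sample s^k still has law D, so the lower bound
    assumed on D applies to the gradient at z^k. *)
Lemma expected_abs_dot_gradient k :
  muD%:E * \int[P]_w (normD (gradient f (z k w)))%:E
  <= \int[P]_w `|dotv (gradient f (z k w)) (s k w)|%:E.
Proof.
have mN := norm_gradient_measurable f_smooth normD L_ge0 (normD_norm HD).
have mNz : measurable_fun setT (fun w => (normD (gradient f (z k w)))%:E).
  by apply/measurable_EFinP; exact: (measurableT_comp mN).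
have N_ge0 y : 0 <= (normD y)%:E by rewrite lee_fin (is_norm_ge0 (normD_norm HD)).
have mu_ge0 : 0 <= muD%:E by rewrite lee_fin ltW// (muD_gt0 HD).
rewrite (independent_tonelli (z k) (s k) D
  (fun p => `|dotv (gradient f p.1) p.2|%:E)) => [|A B mA mB| |p] //; last 2 first.
- rewrite -(smtp_sample run k mB); apply: (smtp_indep run) => //.
  by apply: sub_sigma_algebra; exists k, A; split => //; right; split => //;
    constructor 3.
- exact: abs_dot_gradient_measurable.
rewrite -ge0_integralZl//; apply: ge0_le_integral => //.
- by move=> w _; rewrite mule_ge0.
- exact: emeasurable_funM.
- by apply: (measurableT_comp (measurable_fun_fubini_tonelli_F (m2 := D) _
    abs_dot_gradient_measurable _)).
- move=> w _; have := muD_lower_bound HD (gradient f (z k w)).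
  by rewrite unlock EFinM.
Qed.

Hypotheses (f_diff : forall y, differentiable f y) (beta_lt1 : (beta < 1)%R).
Hypotheses (gamma_gt0 : (0 < gamma)%R).

(** Integrate the pathwise bound. Only nonnegative integrands occur, since
    f (z^K) is bounded from below by m beforehand. *)
Lemma expected_gradient_sum_bound (m : R) (K : nat) :
  (forall y, (m <= f y)%R) ->
  (gamma / (1 - beta) * muD)%:E
    * \sum_(k < K) \int[P]_w (normD (gradient f (z k w)))%:E
  <= (f x0 - m + L / 2 * (gamma / (1 - beta)) ^+ 2 * (K%:R * gammaD))%:E.
Proof.
move=> f_ge; pose eta := (gamma / (1 - beta))%R; rewrite -/eta.
pose h k w : R := `|dotv (gradient f (z k w)) (s k w)|%R.
pose c := (L / 2 * eta ^+ 2)%R.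
have eta_ge0 : (0 <= eta)%R by rewrite divr_ge0 ?subr_ge0 ?ltW.
have c_ge0 : (0 <= c)%R by rewrite mulr_ge0 ?sqr_ge0// divr_ge0.
have mh k : measurable_fun setT (fun w => (h k w)%:E).
  have mzs : measurable_fun setT (fun w => (z k w, s k w)).
    exact: measurable_fun_pair.
  exact: (measurableT_comp abs_dot_gradient_measurable mzs).
have mn k : measurable_fun setT (fun w => (norm2 (s k w) ^+ 2)%:E).
  apply/measurable_EFinP.
  exact: (measurableT_comp sqr_norm2_measurable).
apply: (@le_trans _ _ (eta%:E * \sum_(k < K) \int[P]_w (h k w)%:E)).
  rewrite EFinM -muleA lee_wpmul2l// ge0_sume_distrr.
    by apply: lee_sum => k _; exact: expected_abs_dot_gradient.
  move=> k _; apply: integral_ge0 => w _.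
  by rewrite lee_fin (is_norm_ge0 (normD_norm HD)).
have -> : eta%:E * \sum_(k < K) \int[P]_w (h k w)%:E
    = \int[P]_w (eta * \sum_(k < K) h k w)%:E.
  rewrite -ge0_integral_sum//; last by move=> k w _; rewrite lee_fin /h.
  rewrite -ge0_integralZl//.
  - by apply: eq_integral => w _; rewrite EFinM sumEFin.
  - exact: emeasurable_sum.
  - by move=> w _; apply: sume_ge0 => k _; rewrite lee_fin /h.
have a_ge0 : 0 <= (f x0 - m)%:E by rewrite lee_fin subr_ge0.
have mSn : measurable_fun setT (fun w => \sum_(k < K) (norm2 (s k w) ^+ 2)%:E).
  exact: emeasurable_sum.
have rhsE w : (f x0 - m + c * \sum_(k < K) norm2 (s k w) ^+ 2)%:E
    = (f x0 - m)%:E + c%:E * \sum_(k < K) (norm2 (s k w) ^+ 2)%:E.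
  by rewrite EFinD EFinM sumEFin.
have mrhs : measurable_fun setT
    (fun w => (f x0 - m + c * \sum_(k < K) norm2 (s k w) ^+ 2)%:E).
  under eq_fun do rewrite rhsE.
  by apply: emeasurable_funD => //; exact: emeasurable_funM.
have -> : (f x0 - m + c * (K%:R * gammaD))%:E
    = \int[P]_w (f x0 - m + c * \sum_(k < K) norm2 (s k w) ^+ 2)%:E.
  under eq_integral do rewrite rhsE.
  have Sn_ge0 w : 0 <= \sum_(k < K) (norm2 (s k w) ^+ 2)%:E.
    by apply: sume_ge0 => k _; rewrite lee_fin sqr_ge0.
  rewrite ge0_integralD//; last 2 first.
  - by move=> w _; rewrite mule_ge0.
  - exact: emeasurable_funM.
  rewrite ge0_integralZl// integral_cst//.
  rewrite [X in _%:E * X + _](_ : _ = 1) ?mule1; last exact: probability_setT.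
  rewrite ge0_integral_sum//; last by move=> k w _; rewrite lee_fin sqr_ge0.
  under eq_bigr do rewrite sample_second_moment.
  by rewrite sumEFin sumr_const card_ord EFinD EFinM mulr_natl.
apply: ge0_le_integral => //.
- move=> w _; rewrite lee_fin mulr_ge0// sumr_ge0// => k _; exact: normr_ge0.
- under eq_fun do rewrite EFinM -sumEFin.
  by apply: emeasurable_funM => //; exact: emeasurable_sum.
move=> w _; rewrite lee_fin.
have := pathwise_sum_bound f_diff f_smooth beta_lt1 (smtp_x0 run w)
  (smtp_v0 run w) (smtp_z0 run w) (fun k => smtp_stepP run k w) K.
by have := f_ge (z K w); rewrite -/eta -/c; lra.
Qed.

End expected_descent.

(** * Degenerate constants and the optimal stepsize *)

Section nondegeneracy.
Context {R : realType} {d : nat}.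

(** A negative Lipschitz constant forces every vector to vanish (d = 0); in that
    case smoothness holds with any constant. *)
Lemma L_smooth_ge0 {f : 'rV[R]_d -> R} {L : R} :
  L_smooth f L -> 0 <= L \/ forall x : 'rV[R]_d, norm2 x = 0.
Proof.
move=> f_smooth; have [L_ge0|L_lt0] := leP 0 L; [by left|right=> x].
have := le_trans (norm2_ge0 _) (f_smooth x 0).
by rewrite subr0 nmulr_rge0// => x_le0; apply/le_anti; rewrite x_le0 norm2_ge0.
Qed.

(** If L <= 0 the descent lemma says that f lies below its tangent planes; a
    minimizer then has gradient zero, and f is constant. *)
Lemma L_smooth_gt0 {f : 'rV[R]_d -> R} {L : R} {xstar x : 'rV[R]_d} :
  (forall y, differentiable f y) -> L_smooth f L -> minimizer f xstar ->
  f xstar < f x -> 0 < L.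
Proof.
move=> f_diff f_smooth f_min fx_gt; rewrite ltNge; apply/negP => L_le0.
have below y h : f (y + h) <= f y + dotv (gradient f y) h.
  apply: (le_trans (descent_lemma f_diff f_smooth y h)).
  by rewrite gerDl mulr_le0_ge0 ?sqr_ge0// mulr_le0_ge0.
have grad0 : gradient f xstar = 0.
  apply: norm2_eq0; apply/eqP; rewrite -sqrf_eq0 sqr_norm2.
  rewrite eq_le dotvv_ge0 andbT.
  have := below xstar (- gradient f xstar).
  by have := f_min (xstar - gradient f xstar); rewrite dotvNr; lra.
have := below xstar (x - xstar).
rewrite addrC subrK grad0 -(scale0r 0) dotvZl mul0r addr0.
by rewrite leNgt fx_gt.
Qed.

Context {D : probability 'rV[R]_d R} {gammaD muD : R} {normD : 'rV[R]_d -> R}.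
Hypothesis HD : assumption_D D gammaD muD normD.

Lemma gammaD_ge0 : 0 <= gammaD.
Proof.
rewrite -lee_fin -(second_moment_D HD) unlock.
by apply: integral_ge0 => s _; rewrite lee_fin sqr_ge0.
Qed.

Lemma gammaD_eq0 : (forall x : 'rV[R]_d, norm2 x = 0) -> gammaD = 0.
Proof.
move=> norm2_0; apply/EFin_inj; rewrite -(second_moment_D HD) unlock.
by apply: integral0_eq => s _; rewrite norm2_0 expr0n.
Qed.

(** Integrate |<g, s>| <= |g| |s| <= (t |g|^2 + |s|^2 / t) / 2. The parameter t is
    free, so gammaD = 0 would make the left-hand side arbitrarily small. *)
Lemma muD_norm_le (g : 'rV[R]_d) (t : R) : 0 < t ->
  muD * normD g <= t / 2 * norm2 g ^+ 2 + (2 * t)^-1 * gammaD.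
Proof.
move=> t_gt0; rewrite -lee_fin.
apply: (le_trans (muD_lower_bound HD g)); rewrite unlock.
have mdot : measurable_fun setT (fun s : 'rV[R]_d => `|dotv g s|%:E).
  apply/measurable_EFinP; apply: measurableT_comp => //.
  apply: measurable_sum => i; apply: measurable_funM => //.
  exact: coord_measurable.
have mn2 : measurable_fun setT (fun s : 'rV[R]_d => (norm2 s ^+ 2)%:E).
  by apply/measurable_EFinP; exact: sqr_norm2_measurable.
have c_ge0 : (0 <= ((2 * t)^-1)%:E)%E by rewrite lee_fin invr_ge0 mulr_ge0// ltW.
have a_ge0 : (0 <= (t / 2 * norm2 g ^+ 2)%:E)%E.
  by rewrite lee_fin mulr_ge0 ?sqr_ge0// divr_ge0// ltW.
have rhsE : ((t / 2 * norm2 g ^+ 2 + (2 * t)^-1 * gammaD)%:E =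
    \int[D]_s ((t / 2 * norm2 g ^+ 2)%:E
               + ((2 * t)^-1)%:E * (norm2 s ^+ 2)%:E))%E.
  have := second_moment_D HD; rewrite unlock => m2.
  rewrite ge0_integralD//; last 2 first.
  - by move=> s _; rewrite mule_ge0// lee_fin sqr_ge0.
  - exact: emeasurable_funM.
  rewrite ge0_integralZl//; last by move=> s _; rewrite lee_fin sqr_ge0.
  rewrite integral_cst// [X in (_%:E * X + _)%E](_ : _ = 1%E) ?mule1.
    by rewrite m2.
  exact: probability_setT.
rewrite rhsE; apply: ge0_le_integral => //.
  by apply: emeasurable_funD => //; exact: emeasurable_funM.
move=> s _; rewrite -EFinM -EFinD lee_fin.
apply: (@le_trans _ _ (norm2 g * norm2 s)).
  rewrite ler_norml cauchy_schwarz andbT lerNl -dotvNl -(norm2N g).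
  exact: cauchy_schwarz.
rewrite -subr_ge0.
have -> : t / 2 * norm2 g ^+ 2 + (2 * t)^-1 * norm2 s ^+ 2 - norm2 g * norm2 s
    = (2 * t)^-1 * (t * norm2 g - norm2 s) ^+ 2.
  by field; rewrite gt_eqF.
by rewrite mulr_ge0 ?sqr_ge0// invr_ge0 mulr_ge0// ltW.
Qed.

Lemma gammaD_gt0 (g : 'rV[R]_d) : g != 0 -> 0 < gammaD.
Proof.
move=> g_neq0; rewrite lt_neqAle gammaD_ge0 andbT; apply/eqP => gammaD0.
have muN_gt0 : 0 < muD * normD g.
  by rewrite mulr_gt0 ?(muD_gt0 HD)// (is_norm_gt0 (normD_norm HD)).
have n2_gt0 : 0 < norm2 g ^+ 2.
  by rewrite exprn_even_gt0//=; apply: contra_neq g_neq0 => /norm2_eq0.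
(* this t makes the first term one half of the left-hand side *)
have := @muD_norm_le g _ (divr_gt0 muN_gt0 n2_gt0).
rewrite -gammaD0 mulr0 addr0 mulrAC divfK ?gt_eqF//.
by lra.
Qed.

End nondegeneracy.

(** The excess over the minimum of a / t + b t is b (t - t0)^2 / t. *)
Lemma ratio_linear_min {R : realFieldType} (a b t0 t : R) :
  0 <= b -> 0 < t0 -> b * t0 ^+ 2 = a -> 0 < t -> a / t0 + b * t0 <= a / t + b * t.
Proof.
move=> b_ge0 t0_gt0 <- t_gt0; rewrite -subr_ge0.
have -> : b * t0 ^+ 2 / t + b * t - (b * t0 ^+ 2 / t0 + b * t0)
    = b * (t - t0) ^+ 2 / t.
  by field; rewrite !gt_eqF.
by rewrite divr_ge0 ?(ltW t_gt0)// mulr_ge0 ?sqr_ge0.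
Qed.

(** * The convergence rate *)

Theorem theorem3p1 (R : realType) (d : nat) (f : 'rV[R]_d -> R) (L : R)
    (xstar x0 : 'rV[R]_d) (D : probability 'rV[R]_d R)
    (gammaD muD : R) (normD : 'rV[R]_d -> R) (beta gamma : R) (K : nat)
    (dO : measure_display) (Omega : measurableType dO)
    (P : probability Omega R)
    (s x v z : nat -> {RV P >-> 'rV[R]_d}) (J : Omega -> 'I_K)
    (f_diff : forall y, differentiable f y)
    (f_smooth : L_smooth f L)
    (f_min : minimizer f xstar)
    (HD : assumption_D D gammaD muD normD)
    (beta_ge0 : 0 <= beta) (beta_lt1 : beta < 1)
    (gamma_gt0 : 0 < gamma) (K_gt0 : (0 < K)%N)
    (run : smtp f (fun=> gamma) beta x0 D s x v z)
    (J_unif : uniform_index z J) :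
  let Egrad := 'E_P[fun w => normD (gradient f (z (J w) w))]%E in
  let rhs (gamma0 : R) :=
    (Num.sqrt K%:R)^-1 *
      ((1 - beta) * (f x0 - f xstar) / (gamma0 * muD) +
       L * gamma0 * gammaD / (2 * muD * (1 - beta))) in
  let gamma0_opt :=
    Num.sqrt (2 * (1 - beta) ^+ 2 * (f x0 - f xstar) / (L * gammaD)) in
  [/\ (Egrad <= ((1 - beta) * (f x0 - f xstar) / (K%:R * gamma * muD) +
                 L * gamma * gammaD / (2 * muD * (1 - beta)))%:E)%E,
      forall gamma0 : R, gamma = gamma0 / Num.sqrt K%:R ->
        (Egrad <= (rhs gamma0)%:E)%E,
      (f xstar < f x0 -> 0 < gamma0_opt) /\
        (forall gamma0 : R, 0 < gamma0 -> rhs gamma0_opt <= rhs gamma0)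
    & gamma = gamma0_opt / Num.sqrt K%:R ->
        (Egrad <= (Num.sqrt (2 * (f x0 - f xstar) * L * gammaD) /
                   (muD * Num.sqrt K%:R))%:E)%E].
Proof.
move=> Egrad rhs gamma0_opt.
set A := f x0 - f xstar in rhs gamma0_opt *.
have A_ge0 : 0 <= A by rewrite subr_ge0; exact: f_min.
have b1_gt0 : 0 < 1 - beta by rewrite subr_gt0.
have mu_gt0 : 0 < muD := muD_gt0 HD.
have gD_ge0 : 0 <= gammaD := gammaD_ge0 HD.
have KR_gt0 : 0 < K%:R :> R by rewrite ltr0n.
pose r : R := Num.sqrt K%:R.
have r_gt0 : 0 < r by rewrite sqrtr_gt0.
have rr : r ^+ 2 = K%:R by rewrite sqr_sqrtr// ltW.
(* for d = 0 the constant L may be negative, but then gammaD = 0 *)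
have absL_gD : `|L| * gammaD = L * gammaD.
  have [/ger0_norm -> //|norm2_0] := L_smooth_ge0 f_smooth.
  by rewrite (gammaD_eq0 HD norm2_0) !mulr0.
have LgD_ge0 : 0 <= L * gammaD by rewrite -absL_gD mulr_ge0.
have bound : (Egrad <= ((1 - beta) * A / (K%:R * gamma * muD) +
    L * gamma * gammaD / (2 * muD * (1 - beta)))%:E)%E.
  have f_smooth' := L_smooth_norm f_smooth.
  have := expected_gradient_sum_bound f_smooth' (normr_ge0 L) HD run f_diff
    beta_lt1 gamma_gt0 (f xstar) K f_min.
  have c_gt0 : 0 < gamma / (1 - beta) * muD by rewrite mulr_gt0// divr_gt0.
  rewrite -lee_pdivlMl// -EFinM => sum_le.
  rewrite /Egrad unlock.
  have mN := norm_gradient_measurable f_smooth' normD (normr_ge0 L) (normD_norm HD).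
  rewrite (@uniform_index_integral _ _ _ _ _ z K J
    (fun y => (normD (gradient f y))%:E)) //; last 2 first.
  - exact/measurable_EFinP.
  - by move=> y; rewrite lee_fin (is_norm_ge0 (normD_norm HD)).
  have Kinv_ge0 : (0 <= (K%:R^-1)%:E :> \bar R)%E by rewrite lee_fin invr_ge0.
  apply: (le_trans (lee_wpmul2l Kinv_ge0 sum_le)).
  rewrite -EFinM lee_fin le_eqVlt; apply/orP; left; apply/eqP.
  rewrite (_ : `|L| / 2 * (gamma / (1 - beta)) ^+ 2 * (K%:R * gammaD)
    = L * gammaD * (K%:R * (gamma / (1 - beta)) ^+ 2 / 2)); last first.
    by rewrite -absL_gD; ring.
  by rewrite -/A; field; rewrite !gt_eqF.
have bound_rhs gamma0 : gamma = gamma0 / r -> (Egrad <= (rhs gamma0)%:E)%E.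
  move=> gammaE; apply: (le_trans bound); rewrite lee_fin /rhs -/r.
  have -> : gamma0 = gamma * r by rewrite gammaE divfK ?gt_eqF.
  rewrite le_eqVlt; apply/orP; left; apply/eqP.
  by rewrite -rr; field; rewrite !gt_eqF.
have opt_sqr : 0 < gamma0_opt ->
    L * gammaD * gamma0_opt ^+ 2 = 2 * (1 - beta) ^+ 2 * A.
  rewrite sqrtr_gt0 => opt_gt0; rewrite sqr_sqrtr ?(ltW opt_gt0)// mulrC divfK//.
  by apply: contraTneq opt_gt0 => ->; rewrite invr0 mulr0 ltxx.
pose a := (1 - beta) * A / muD; pose b := L * gammaD / (2 * muD * (1 - beta)).
have b_ge0 : 0 <= b by rewrite divr_ge0// ltW// !mulr_gt0.
have rhsE gamma0 : rhs gamma0 = r^-1 * (a / gamma0 + b * gamma0).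
  by rewrite /rhs /a /b -/r invfM; ring.
split => //.
- split => [A_gt0|gamma0 gamma0_gt0].
    have L_gt0 := L_smooth_gt0 f_diff f_smooth f_min A_gt0.
    have x0_neq : x0 - xstar != 0.
      by rewrite subr_eq0; apply: contraTneq A_gt0 => ->; rewrite ltxx.
    have gD_gt0 := gammaD_gt0 HD _ x0_neq.
    by rewrite sqrtr_gt0 divr_gt0 ?mulr_gt0 ?exprn_gt0 ?subr_gt0.
  rewrite !rhsE ler_wpM2l ?invr_ge0 ?(ltW r_gt0)//.
  have [opt_gt0|opt_le0] := ltP 0 gamma0_opt.
    apply: ratio_linear_min => //; rewrite /a /b.
    rewrite mulrAC opt_sqr//.
    by field; rewrite !gt_eqF.
  have -> : gamma0_opt = 0 by apply/le_anti; rewrite opt_le0 sqrtr_ge0.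
  rewrite invr0 !mulr0 addr0 addr_ge0//; last by rewrite mulr_ge0// ltW.
  by rewrite divr_ge0 ?(ltW gamma0_gt0)// divr_ge0 ?mulr_ge0// ltW.
- move=> gammaE; apply: (le_trans (bound_rhs _ gammaE)).
  have opt_gt0 : 0 < gamma0_opt.
    have -> : gamma0_opt = gamma * r by rewrite gammaE divfK ?gt_eqF.
    exact: mulr_gt0.
  rewrite lee_fin rhsE le_eqVlt; apply/orP; left; apply/eqP.
  have aE : a = b * gamma0_opt ^+ 2.
    rewrite /a /b [RHS]mulrAC opt_sqr//.
    by field; rewrite !gt_eqF.
  have -> : Num.sqrt (2 * A * L * gammaD) = L * gammaD * gamma0_opt / (1 - beta).
    have rhs_ge0 : 0 <= L * gammaD * gamma0_opt / (1 - beta).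
      by rewrite divr_ge0 ?(ltW b1_gt0)// mulr_ge0// ltW.
    rewrite -(ger0_norm rhs_ge0) -sqrtr_sqr; congr Num.sqrt.
    have -> : (L * gammaD * gamma0_opt / (1 - beta)) ^+ 2
        = L * gammaD * (L * gammaD * gamma0_opt ^+ 2) / (1 - beta) ^+ 2.
      by field; rewrite gt_eqF.
    by rewrite opt_sqr//; field; rewrite gt_eqF.
  by rewrite aE /b -/r; field; rewrite !gt_eqF.
Qed.
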